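(* Let $\Gamma=(\Gamma_0,\Gamma_1,d)$ be a directed graph with transition rates $k_\alpha:\mathbb{R}\to[0,\infty)$, $\alpha\in\Gamma_1$, which, if $\Gamma$ is infinite, satisfies the rate bound and the degree bound. Let $\mathbb{H}=\mathbb{H}(t)$ be the associated master operator, let $q:\Gamma_0\to\mathbb{R}_+$ be a probability distribution, and let $p(t)$ denote the formal solution to the master equation $p'(t)=\mathbb{H}(t)p(t)$, $p(0)=q$. Then $p(t)$ is a probability distribution on $\Gamma_0$ for every $t\ge0$. In particular, the function $f$ is a probability density on the space $\mathcal{T}(\Gamma,t)$ of trajectories of duration $t$ of arbitrary length.
   Context: Graphs. A directed graph $\Gamma=(\Gamma_0,\Gamma_1,d)$ consists of a set $\Gamma_0$ of vertices, a set $\Gamma_1$ of edges and a function $d=(d_0,d_1):\Gamma_1\to(\Gamma_0\times\Gamma_0)\setminus\Delta$, where $\Delta$ is the diagonal; $d_0(\alpha)$ is the source and $d_1(\alpha)$ the target of $\alpha$. So multiple edges are allowed and loops are not. Graphs are assumed locally finite in the sense that only finitely many edges have a given set of endpoints. Markov chain. A continuous time Markov chain with state diagram $\Gamma$ is an assignment of a continuous function $k_\alpha:\mathbb{R}\to[0,\infty)$ (the transition rate) to each edge $\alpha\in\Gamma_1$. If $\Gamma$ is infinite the following are assumed (they hold automatically if $\Gamma$ is finite). Rate bound: for each $t>0$ there is a constant $R$, possibly depending on $t$, with $k_\alpha(s)\le R$ for all $0\le s\le t$ and all $\alpha\in\Gamma_1$. Degree bound: there is a positive integer $D$ such that every vertex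 $i$ has degree (number of edges having $i$ as source or target) at most $D$. Master operator. For $i\ne j$ in $\Gamma_0$ put $h_{ij}(t)=\sum_{\alpha:\,d(\alpha)=(j,i)}k_\alpha(t)$ (zero if there are no such edges), and put $h_{ii}(t)=-\sum_{\ell\neq i}h_{\ell i}(t)$. The master operator is the $\Gamma_0\times\Gamma_0$ matrix $\mathbb{H}(t)=(h_{ij}(t))$; its columns sum to zero. Formal solution. Write $\mathbb{H}=A_0+A_1$ with $A_0$ the diagonal matrix with entries $h_{ii}$ and $A_1$ the off-diagonal part. The formal solution of $p'=\mathbb{H}p$, $p(0)=q$, is the series $p=\sum_{n\ge0}p^n$ obtained by setting $\epsilon=1$ in the formal power series solution $\sum_{n\ge 0}\epsilon^np^n$ of $p'=(A_0+\epsilon A_1)p$ with $p^0(0)=q$ and $p^n(0)=0$ for $n>0$; that is, the $p^n$ are the vector valued functions of $t\ge 0$ determined componentwise by $(p^n)'=A_0p^n+A_1p^{n-1}$ for $n\ge0$, with $p^{-1}:=0$, and these initial conditions. That $p(t)$ is a probability distribution means that the series $p_i(t)=\sum_n p_i^n(t)$ converges to a non-negative number for each $i\in\Gamma_0$ and $\sum_{i\in\Gamma_0}p_i(t)=1$. Paths and trajectories. A path of length $n$ in $\Gamma$ is a sequence of edges $\alpha_\bullet=(\alpha_1,\dots,\alpha_n)$ with $d_1(\alpha_k)=d_0(\alpha_{k+1})$ for $1\le k<n$; its vertices are $i_k=d_0(\alpha_k)$ for $k\le n$ and $i_{n+1}=d_1(\alpha_n)$. A path of length $0$ is a vertex $i_1$.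 $\mathcal{P}(\Gamma,n)$ denotes the set of paths of length $n$. A trajectory of length $n$ and duration $t>0$ is a pair $(\alpha_\bullet,t_\bullet)$ with $\alpha_\bullet$ a path of length $n$ and $t_\bullet=(t_1,\dots,t_n)$ real numbers with $0\le t_1\le\cdots\le t_n\le t$; set $t_0:=0$, $t_{n+1}:=t$. $\mathcal{T}(\Gamma,t)$ is the set of all trajectories of duration $t$ of all lengths $n\ge0$, i.e. the disjoint union over $n\ge 0$ and $\alpha_\bullet\in\mathcal{P}(\Gamma,n)$ of the simplices $\{0\le t_1\le\cdots\le t_n\le t\}$, with reference measure given by Lebesgue measure $dt_1\cdots dt_n$ on each simplex (unit point mass when $n=0$). The function $f$. For $i\in\Gamma_0$ and an interval $[a,b]$ put $$u_i(a,b)=\exp\Big(-\sum_{\alpha:\,d_0(\alpha)=i}\int_a^bk_\alpha(s)\,ds\Big)=\exp\Big(\int_a^bh_{ii}(s)\,ds\Big).$$ For a trajectory of length $n$ and duration $t$ define $$f(\alpha_\bullet,t_\bullet)=q_{i_1}\prod_{m=1}^{n+1}u_{i_m}(t_{m-1},t_m)\prod_{m=1}^{n}k_{\alpha_m}(t_m),$$ where $q_j:=q(j)$. That $f$ is a probability density on $\mathcal{T}(\Gamma,t)$ means that $f\ge0$ and $$\sum_{n=0}^\infty\ \sum_{\alpha_\bullet\in\mathcal{P}(\Gamma,n)}\int_0^t\int_0^{t_n}\cdots\int_0^{t_2}f(\alpha_\bullet,t_\bullet)\,dt_1\cdots dt_n=1,$$ where for $n=0$ there is no integration and the summand at the vertex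 $i$ is $q_iu_i(0,t)$. *)

(* Defs.v *)
From HB Require Import structures.
From mathcomp Require Import all_boot all_order all_algebra.
From mathcomp Require Import all_classical all_reals all_analysis.

Set Implicit Arguments.
Unset Strict Implicit.
Unset Printing Implicit Defensive.

Import Order.TTheory GRing.Theory Num.Theory.
Import numFieldNormedType.Exports.

Local Open Scope classical_set_scope.
Local Open Scope ring_scope.

(* Local finiteness: only finitely many edges have a given set [B] of
   endpoints. *)
Record digraph : Type := Digraph {
  vertex : choiceType;
  edge : choiceType;
  src : edge -> vertex;
  tgt : edge -> vertex;
  src_neq_tgt : forall a : edge, src a <> tgt a;
  locally_finite :
    forall B : set vertex, finite_set [set a | [set src a; tgt a] = B]
}.

Definition finite_digraph (G : digraph) : Prop :=
  finite_set [set: vertex G] /\ finite_set [set: edge G].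

Definition rate_bound (R : realType) (G : digraph) (k : edge G -> R -> R) :
    Prop :=
  forall t : R, 0 < t -> exists C : R,
    forall (s : R) (a : edge G), 0 <= s <= t -> k a s <= C.

Definition degree_bound (G : digraph) : Prop :=
  exists2 D : nat, (0 < D)%N &
    forall i : vertex G, ([set a | src a = i \/ tgt a = i] #<= `I_D)%card.

Definition transition_rates (R : realType) (G : digraph)
    (k : edge G -> R -> R) : Prop :=
  [/\ forall a, continuous (k a),
      forall a s, 0 <= k a s &
      ~ finite_digraph G -> rate_bound k /\ degree_bound G].

Definition prob_dist (R : realType) (V : choiceType) (q : V -> R) : Prop :=
  (forall i, 0 <= q i) /\ \esum_(i in [set: V]) (q i)%:E = 1%E.

(* Sums over [\in] are finitely supported sums (their value is 0 on an infinite
   support); for transition rates of a digraph as above all the supports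
   occurring below are finite. *)

(* The entry h_ij of the master operator for i <> j: the total rate j -> i. *)
Definition total_rate (R : realType) (G : digraph) (k : edge G -> R -> R)
    (i j : vertex G) (t : R) : R :=
  \sum_(a \in [set a | src a = j /\ tgt a = i]) k a t.

Definition master_op (R : realType) (G : digraph) (k : edge G -> R -> R)
    (i j : vertex G) (t : R) : R :=
  if i == j then - \sum_(l \in [set l | l <> i]) total_rate k l i t
  else total_rate k i j t.

(* [g] has derivative [l] at [t] as a function on [0, +oo[ (so the derivative is
   one-sided at [t = 0]). *)
Definition is_derive_nneg (R : realType) (g : R -> R) (t l : R) : Prop :=
  (g s - g t) / (s - t) @[s --> within [set s | 0 <= s] t^'] --> l.

(* [p n i t] is p^n_i(t); only its values at [0 <= t] are meaningful. *)
Definition is_formal_solution (R : realType) (G : digraph)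
    (k : edge G -> R -> R) (q : vertex G -> R)
    (p : nat -> vertex G -> R -> R) : Prop :=
  (forall n i, p n i 0 = if n is 0%N then q i else 0) /\
  (forall n i (t : R), 0 <= t ->
     is_derive_nneg (p n i) t
       (master_op k i i t * p n i t +
        (if n is m.+1
         then \sum_(j \in [set j | j <> i]) master_op k i j t * p m j t
         else 0))).

Definition series_is_prob_dist (R : realType) (V : choiceType)
    (p : nat -> V -> R -> R) (t : R) : Prop :=
  (forall i, cvgn (series (fun n => p n i t))) /\
  prob_dist (fun i => limn (series (fun n => p n i t))).

(* A path of length [n] is a pair of its initial vertex i_1 and its edges; the
   initial vertex is redundant unless [n = 0]. *)
Definition paths (G : digraph) (n : nat) : set (vertex G * n.-tuple (edge G)) :=
  [set x : vertex G * n.-tuple (edge G) |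
     sorted (fun a b => tgt a == src b) x.2 /\
           head x.1 (map (@src G) x.2) = x.1].

(* The vertices i_1, ..., i_{n+1} of a path. *)
Definition path_vertices (G : digraph) (n : nat)
    (x : vertex G * n.-tuple (edge G)) : seq (vertex G) :=
  rcons (map (@src G) x.2) (last x.1 (map (@tgt G) x.2)).

(* The times t_0 = 0, t_1, ..., t_n, t_{n+1} = t. *)
Definition times (R : realType) (n : nat) (t : R) (ts : n.-tuple R) : seq R :=
  0 :: rcons ts t.

Definition is_trajectory (R : realType) (G : digraph) (t : R) (n : nat)
    (x : vertex G * n.-tuple (edge G)) (ts : n.-tuple R) : Prop :=
  paths x /\ sorted <=%R (times t ts).

Definition stay_prob (R : realType) (G : digraph) (k : edge G -> R -> R)
    (i : vertex G) (a b : R) : R :=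
  expR (- \sum_(e \in [set e | src e = i])
            \int[@lebesgue_measure R]_(s in `[a, b]) k e s).

(* With 0-based indices, factor [m] of the first product is
   u_{i_{m+1}}(t_m, t_{m+1}). *)
Definition trajectory_density (R : realType) (G : digraph)
    (k : edge G -> R -> R) (q : vertex G -> R) (t : R) (n : nat)
    (x : vertex G * n.-tuple (edge G)) (ts : n.-tuple R) : R :=
  q x.1 *
  (\prod_(m < n.+1) stay_prob k (nth x.1 (path_vertices x) m)
                      (nth 0 (times t ts) m) (nth 0 (times t ts) m.+1)) *
  (\prod_(m < n) k (tnth x.2 m) (tnth ts m)).

(* The iterated integral
   \int_0^t \int_0^{t_n} ... \int_0^{t_2} F(t_1, ..., t_n) dt_1 ... dt_n. *)
Fixpoint simplex_integral (R : realType) (n : nat) (t : R) {struct n} :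
    (n.-tuple R -> R) -> \bar R :=
  match n return (n.-tuple R -> R) -> \bar R with
  | 0 => fun F => (F [tuple])%:E
  | m.+1 => fun F =>
      (\int[@lebesgue_measure R]_(s in `[0%R, t])
         simplex_integral s (fun ts : m.-tuple R => F [tuple of rcons ts s]))%E
  end.

(* [F] is a probability density on the space of trajectories of duration [t]. *)
Definition trajectory_prob_density (R : realType) (G : digraph) (t : R)
    (F : forall n, vertex G * n.-tuple (edge G) -> n.-tuple R -> R) : Prop :=
  (forall n (x : vertex G * n.-tuple (edge G)) (ts : n.-tuple R),
     is_trajectory t x ts -> 0 <= F n x ts) /\
  (\sum_(0 <= n <oo)
     \esum_(x in @paths G n) simplex_integral t (F n x) = 1)%E.

(* Main.v *)
(* For a path of length n starting at j, integrate the trajectory density with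
   q = delta_j over the simplex of jump times; call the result w. Isolating the
   last edge a and its jump time s shows
     w' = - (exit rate of the end vertex) w + k_a v,
   where v is the weight of the path without a. Summing over
   the paths ending at i gives the n-th term p^n_i of the formal solution
   (unique by the uniqueness for scalar linear equations), and all sums are
   finite by the degree bound. Summing over the paths starting at j instead, the
   loss of level n is the gain of level n+1, so the total mass of the levels
   0, ..., n decreases only through the outflow of level n. With M a bound on the
   exit rates, the mass of level n is at most (M t)^n / n!, hence the mass
   missing from the levels 0, ..., n is at most (M t)^(n+1) / (n+1)!, which tends
   to 0. Averaging over j with weights q_j and exchanging sums of nonnegative
   terms yields both claims. *)
Require Import Defs.
From mathcomp Require Import all_boot all_order all_algebra.
From mathcomp Require Import all_classical all_reals all_analysis.
From mathcomp Require Import ring.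
Import Order.TTheory GRing.Theory Num.Theory.
Import numFieldNormedType.Exports.
Local Open Scope classical_set_scope.
Local Open Scope ring_scope.

(** * Primitives of continuous functions and comparison of derivatives *)

Section Calculus.
Variable R : realType.
Implicit Types (f F : R -> R) (a b t : R).
Local Notation mu := (@lebesgue_measure R).

Lemma continuous_integrable_itv f a b : continuous f ->
  mu.-integrable `[a, b] (EFin \o f).
Proof.
move=> cf; apply: continuous_compact_integrable; first exact: segment_compact.
exact: continuous_subspaceT.
Qed.

Lemma derive_continuous F f :
  (forall t, is_derive t 1 F (f t)) -> continuous F.
Proof.
move=> dF t; have [+ _] := dF t.
by move=> /derivable1_diffP/differentiable_continuous.
Qed.

(* Defined for negative [t] too, so that the derivative at 0 is two-sided. *)
Definition primitive f t : R :=
  \int[mu]_(s in `[0, t]) f s - \int[mu]_(s in `[t, 0]) f s.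

Lemma primitive0 f : primitive f 0 = 0.
Proof. by rewrite /primitive subrr. Qed.

(** Removes the case distinction on the sign of [t]: with one base point [c] to the left of both 0
    and [t], the primitive is an integral with fixed lower end minus a constant, the form covered by
    the fundamental theorem. *)
Lemma primitive_shift f c t : continuous f -> c <= 0 -> c <= t ->
  primitive f t =
  \int[mu]_(s in `[c, t]) f s - \int[mu]_(s in `[c, 0]) f s.
Proof.
move=> cf c0 ct; rewrite /primitive; have [t0|t0] := leP 0 t.
  rewrite (@Rintegral_itvB _ f (BLeft c) (BRight t) 0) ?bnd_simp//; last first.
    exact: continuous_integrable_itv.
  rewrite Rintegral_itv_obnd_cbnd; last first.
    apply: integrableS (continuous_integrable_itv f 0 t cf) => //.
    exact: subset_itv_oc_cc.
  move: t0; rewrite le_eqVlt => /predU1P[<-|t0].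
    by rewrite set_itv1 Rintegral_set1 subr0.
  by rewrite [`[t, 0]%classic]set_itv_ge ?bnd_simp -?ltNge// Rintegral_set0 subr0.
rewrite -[RHS]opprB (@Rintegral_itvB _ f (BLeft c) (BRight 0) t) ?bnd_simp ?(ltW t0)//;
  last exact: continuous_integrable_itv.
rewrite Rintegral_itv_obnd_cbnd; last first.
  apply: integrableS (continuous_integrable_itv f t 0 cf) => //.
  exact: subset_itv_oc_cc.
by rewrite [`[0, t]%classic]set_itv_ge ?bnd_simp -?ltNge// Rintegral_set0 sub0r.
Qed.

Lemma is_derive_primitive f t :
  continuous f -> is_derive t 1 (primitive f) (f t).
Proof.
(* This base point lies strictly below [t], so [primitive_shift] applies on a whole neighbourhood of
   [t]. *)
move=> cf; pose c := Num.min 0 t - 1.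
have c0 : c <= 0 by rewrite /c lerBlDr ge_min add0r ler01.
have ct : c < t by rewrite /c ltrBlDr gt_min ltrDl ltr01 orbT.
have [df f'] := @continuous_FTC1_closed _ f c t (t + 1) ltac:(by rewrite ltrDl)
  (continuous_integrable_itv f c (t + 1) cf) ct (cf t).
have dF : is_derive t 1 (fun x => \int[mu]_(s in `[c, x]) f s) (f t).
  by apply: DeriveDef; [exact: df|rewrite -derive1E].
apply: (@near_eq_is_derive _ _ _ (fun x : R =>
    \int[mu]_(s in `[c, x]) f s - \int[mu]_(s in `[c, 0]) f s)).
- near=> x; apply/esym/primitive_shift => //; apply/ltW; near: x; exact: lt_nbhsr.
- by rewrite -[f t]subr0; apply: is_deriveB.
Unshelve. all: by end_near. Qed.

Lemma integral_is_derive F f a b : continuous f ->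
  (forall t, is_derive t 1 F (f t)) -> a <= b ->
  (\int[mu]_(s in `[a, b]) (f s)%:E = (F b - F a)%:E)%E.
Proof.
move=> cf dF; have cF := derive_continuous F f dF.
rewrite le_eqVlt => /predU1P[<-|ab].
  by rewrite set_itv1 integral_set1 subrr.
rewrite (continuous_FTC2 (F := F)) ?EFinB//.
- exact: continuous_subspaceT.
- split=> [x _||]; [by case: (dF x)| |].
  + by apply: cvg_at_right_filter; exact: cF.
  + by apply: cvg_at_left_filter; exact: cF.
- by move=> x _; rewrite derive1E; case: (dF x).
Qed.

Lemma integral_primitive f a b : continuous f -> a <= b ->
  (\int[mu]_(s in `[a, b]) (f s)%:E = (primitive f b - primitive f a)%:E)%E.
Proof. by move=> cf; apply: integral_is_derive => // t; exact: is_derive_primitive. Qed.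

Lemma primitive_ge0 f t : 0 <= t -> continuous f ->
  (forall s, 0 <= s -> 0 <= f s) -> 0 <= primitive f t.
Proof.
move=> t0 cf f0.
have := integral_primitive f 0 t cf t0; rewrite primitive0 subr0 -lee_fin => <-.
by apply: integral_ge0 => s /=; rewrite in_itv/= lee_fin => /andP[+ _]; exact: f0.
Qed.

Lemma ge0_is_derive_le F f t : 0 <= t -> (forall s : R, is_derive s 1 F (f s)) ->
  (forall s, 0 <= s <= t -> 0 <= f s) -> F 0 <= F t.
Proof.
move=> t0 dF f0.
have [|x] := @MVT_segment _ F f 0 t t0 (fun x _ => dF x).
  by apply: continuous_subspaceT; exact: derive_continuous dF.
by rewrite in_itv/= => /f0 fx e; rewrite -subr_ge0 e mulr_ge0// subr0.
Qed.

Lemma exp_coeff0S n : exp_coeff (0 : R) n.+1 = 0.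
Proof. by rewrite /exp_coeff/= expr0n mul0r. Qed.

(** The functions (M t)^n / n! are the comparison functions for the mass of level n; each is, up to
    the factor M, the derivative of the next. *)
Lemma is_derive_exp_coeff (M t : R) n :
  is_derive t 1 (fun s => exp_coeff (M * s) n.+1) (M * exp_coeff (M * t) n).
Proof.
rewrite (_ : (fun s => _) = (n.+1)`!%:R^-1 \*: ((M \*: id) ^+ n.+1)).
  apply: is_derive_eq; rewrite /exp_coeff/= /GRing.scale/= factS natrM; field.
  by rewrite nat1r !pnatr_eq0 -lt0n fact_gt0.
by apply/funext => s; rewrite /exp_coeff/= !fctE /GRing.scale/= mulrC.
Qed.

End Calculus.

(** * One-sided derivatives and uniqueness for scalar linear equations *)

Section OneSidedDerivative.
Variable R : realType.
Implicit Types (f g a b : R -> R) (t l : R).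

(** The substitution s = t + h turns the difference quotient at h = 0 into the slope at [t], the
    form in which [is_derive_nneg] is stated. *)
Lemma is_derive_slope g t l :
  is_derive t 1 g l <-> (g s - g t) / (s - t) @[s --> t^'] --> l.
Proof.
have E : (fun h : R => h^-1 *: ((g \o shift t) (h *: 1) - g t)) @ 0^' =
         (fun s => (g s - g t) / (s - t)) @ t^'.
  apply/funext => A; apply/propext.
  change ((\forall h \near (0 : R), h != 0 ->
             A (h^-1 *: (g (h *: 1 + t) - g t))) <->
          (\forall s \near t, s != t -> A ((g s - g t) / (s - t)))).
  rewrite (near_shift (0 : R) t) subr0 -propeqE; congr (nbhs _ _).
  apply/funext => h /=; rewrite /GRing.scale/= mulr1 addrK mulrC.
  by rewrite -(subr_eq0 (h + t)) addrK.
split=> [[d <-]|d].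
  by rewrite -E; exact: d.
by rewrite -E in d; apply: DeriveDef; [apply/cvg_ex; exists l|exact: cvg_lim].
Qed.

Lemma is_derive_is_derive_nneg g t l :
  is_derive t 1 g l -> is_derive_nneg g t l.
Proof. by move=> /is_derive_slope; apply: cvg_trans; exact/cvg_app/cvg_within. Qed.

Lemma is_derive_nnegM f g t l m : is_derive_nneg f t l -> is_derive t 1 g m ->
  is_derive_nneg (f \* g) t (l * g t + f t * m).
Proof.
move=> df dg; have dg' := is_derive_is_derive_nneg _ _ _ dg.
have cg : g s @[s --> within [set s | 0 <= s] t^'] --> g t.
  do 2!apply: cvg_within_filter.
  by have [+ _] := dg => /derivable1_diffP/differentiable_continuous.
rewrite /is_derive_nneg.
(* In this splitting of the product only [g] is evaluated at the moving point [s], so only the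
   continuity of [g] is needed. *)
rewrite (_ : (fun s => _) = (fun s => (f s - f t) / (s - t) * g s +
    f t * ((g s - g t) / (s - t)))).
  by apply: cvgD; apply: cvgM => //; exact: cvg_cst.
by apply/funext => s /=; move: (s - t)^-1 => c; ring.
Qed.

Lemma is_derive_nnegB f g t l m : is_derive_nneg f t l -> is_derive_nneg g t m ->
  is_derive_nneg (f \- g) t (l - m).
Proof.
move=> df dg; rewrite /is_derive_nneg.
rewrite (_ : (fun s => _) = (fun s => (f s - f t) / (s - t) -
    (g s - g t) / (s - t))); first exact: cvgB.
by apply/funext => s /=; move: (s - t)^-1 => c; ring.
Qed.

(** Extended to the left by the constant [f 0], the function has two-sided derivative 0 everywhere:
    at 0 the left slopes vanish and the right slopes tend to 0 by hypothesis. *)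
Lemma is_derive_nneg0_cst f : (forall t, 0 <= t -> is_derive_nneg f t 0) ->
  forall t, 0 <= t -> f t = f 0.
Proof.
move=> df t t0; pose F (s : R) := f (Num.max 0 s).
have dF (x : R) : is_derive x 1 F 0.
  have [x0|x0] := ltP x 0.
    apply: (@near_eq_is_derive _ _ _ (cst (f 0))).
    near=> s; rewrite /F max_l//; apply/ltW; near: s; exact: lt_nbhsl.
  apply/is_derive_slope/cvgrPdist_le => /= e e0.
  have /cvgrPdist_le/(_ e e0) := df _ x0.
  rewrite !near_withinE => H.
  (* Consequently a negative [s] near [x] forces x = 0, and there the slope of [F] is exactly 0. *)
  have N : \forall s \near x, 0 < x -> 0 <= s.
    have [xp|_] := ltP 0 x; last by near=> s.
    by near=> s => _; apply/ltW; near: s; exact: lt_nbhsr.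
  near=> s => sx; have [s0|s0] := leP 0 s.
    by rewrite /F !max_r//; move: sx s0; near: s.
  suff -> : x = 0 by rewrite /F max_l ?(ltW s0)// maxxx subrr mul0r subrr normr0 ltW.
  apply/eqP; move: x0; rewrite le_eqVlt eq_sym => /orP[//|xp].
  suff : 0 <= s by rewrite leNgt s0.
  by move: xp; near: s.
have := is_derive_0_is_cst t 0 dF.
by rewrite /F maxxx max_r.
Unshelve. all: by end_near. Qed.

(** The difference of two solutions times the integrating factor [E] has derivative 0 and initial
    value 0, and [E] never vanishes. *)
Lemma linear_ode_unique a b f g : continuous a ->
  (forall t, 0 <= t -> is_derive_nneg f t (a t * f t + b t)) ->
  (forall t, 0 <= t -> is_derive_nneg g t (a t * g t + b t)) ->
  f 0 = g 0 -> forall t, 0 <= t -> f t = g t.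
Proof.
move=> ca df dg fg0 t t0; pose E s := expR (- primitive R a s).
have dE (s : R) : is_derive s 1 E (- a s * E s).
  rewrite mulrC; apply: is_derive1_comp.
  by apply: is_deriveN; exact: is_derive_primitive.
have := is_derive_nneg0_cst ((f \- g) \* E).
move=> /(_ _ t t0) /=; rewrite fg0 subrr mul0r => H.
have E0 : E t != 0 by exact/lt0r_neq0/expR_gt0.
apply/eqP; rewrite -subr_eq0 -(mulIr_eq0 _ (mulIf E0)).
apply/eqP/H => s s0.
have := is_derive_nnegM _ _ _ _ _ (is_derive_nnegB _ _ _ _ _ (df _ s0) (dg _ s0)) (dE s).
congr is_derive_nneg => /=.
by ring.
Qed.

End OneSidedDerivative.

(** * Regrouping of sums, and products along extended tuples *)

Section FiniteSums.
Variable R : realType.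

(** Turns the sums over vertices in the master operator into sums over edges. The set [B] may be
    infinite, but only the finitely many values of [g] on [A] have nonempty fibres. *)
Lemma fsum_fibre (T U : choiceType) (A : set T) (B : set U) (g : T -> U)
    (F : U -> T -> R) : finite_set A -> (forall a, A a -> B (g a)) ->
  \sum_(l \in B) \sum_(a \in A `&` g @^-1` [set l]) F l a =
  \sum_(a <- finmap.enum_fset (fset_set A)) F (g a) a.
Proof.
move=> fA AB; pose r := finmap.enum_fset (fset_set A); pose s := undup (map g r).
have memr a : (a \in r) = (a \in A) by rewrite /r in_fset_set.
have ss l : l \in s -> l \in B.
  by rewrite mem_undup => /mapP[a + ->]; rewrite memr !inE; exact: AB.
rewrite (@fsbigE _ _ _ _ _ s) ?undup_uniq//; first last.
- move=> l _ ls; apply: fsbig1 => a [Aa gal]; move: ls.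
  rewrite mem_undup => /negP[]; apply/mapP; exists a => //.
  by rewrite memr inE.
- by move=> l /ss; rewrite inE.
transitivity (\sum_(l <- s) \sum_(a <- r | g a == l) F l a).
  rewrite big_mkcond; apply: eq_big_seq => l /ss ->.
  rewrite fsbig_mkcondr fsbig_finite// [RHS]big_mkcond; apply: eq_bigr => a _.
  by congr (if _ then _ else _); apply/idP/eqP; rewrite inE.
rewrite (exchange_big_dep xpredT)//=; apply: eq_big_seq => a ar.
rewrite big_mkcond (bigD1_seq (g a))/= ?undup_uniq ?mem_undup ?map_f// eqxx.
by rewrite big1 ?addr0// => l; rewrite eq_sym => /negbTE ->.
Qed.

Lemma esum_exchange (T U : choiceType) (A : set T) (B : set U)
    (F : T -> U -> \bar R) : (forall x y, A x -> B y -> 0 <= F x y)%E ->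
  (\esum_(x in A) \esum_(y in B) F x y = \esum_(y in B) \esum_(x in A) F x y)%E.
Proof.
move=> F0; rewrite !esum_esum//; last by move=> y x By Ax; exact: F0.
rewrite (reindex_esum (B `*`` (fun=> A)) _ (fun z => (z.2, z.1)))//.
split=> [[y x] [By Ax]//|[y x] [y' x'] _ _ [-> ->]//|[x y] [Ax By]].
by exists (y, x).
Qed.

(** Splits off the last holding interval; [us] has one entry more than [xs] because n intervals have
    n + 1 endpoints. *)
Lemma prod_nth_rcons (T : Type) (F : T -> R -> R -> R) n x0 xs x us (u : R) :
  size xs = n -> size us = n.+1 ->
  \prod_(m < n.+1) F (nth x0 (rcons xs x) m) (nth 0 (rcons us u) m)
                     (nth 0 (rcons us u) m.+1) =
  (\prod_(m < n) F (nth x0 xs m) (nth 0 us m) (nth 0 us m.+1)) *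
  F x (nth 0 us n) u.
Proof.
move=> xsS usS; rewrite big_ord_recr /= !nth_rcons xsS usS ltnn eqxx ltnSn.
rewrite ltnn eqxx; congr (_ * _); apply: eq_bigr => m _.
by rewrite !nth_rcons xsS usS !ltnS ltn_ord ltnW.
Qed.

Lemma prod_tnth_rcons (T : Type) (F : T -> R -> R) n (xs : n.-tuple T) x
    (us : n.-tuple R) u :
  \prod_(m < n.+1) F (tnth [tuple of rcons xs x] m) (tnth [tuple of rcons us u] m) =
  (\prod_(m < n) F (tnth xs m) (tnth us m)) * F x u.
Proof.
rewrite big_ord_recr !(tnth_nth x) !(tnth_nth 0) /= !nth_rcons !size_tuple.
rewrite ltnn eqxx; congr (_ * _); apply: eq_bigr => m _.
by rewrite !(tnth_nth x) !(tnth_nth 0)/= !nth_rcons !size_tuple ltn_ord.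
Qed.

Lemma tuple_rcons (T : Type) n (e : n.+1.-tuple T) :
  exists y : n.-tuple T, exists a, e = [tuple of rcons y a].
Proof.
case: e => e; case/lastP: e => // e a sz.
have sz' : size e == n by rewrite size_rcons eqSS in sz.
by exists (Tuple sz'), a; exact: val_inj.
Qed.

Lemma continuous_sum_seq (I : Type) (s : seq I) (h : I -> R -> R) :
  (forall i, continuous (h i)) -> continuous (fun t => \sum_(i <- s) h i t).
Proof.
move=> ch; elim: s => [|i s IHs].
  by under eq_fun do rewrite big_nil; exact: cst_continuous.
under eq_fun do rewrite big_cons.
by move=> t; apply: cvgD; [exact: ch|exact: IHs].
Qed.

Lemma is_derive_sum_seq (I : Type) (s : seq I) (h : I -> R -> R) (dh : I -> R)
    (t : R) : (forall i, is_derive t 1 (h i) (dh i)) ->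
  is_derive t 1 (fun t => \sum_(i <- s) h i t) (\sum_(i <- s) dh i).
Proof.
move=> dh_; elim: s => [|i s IHs].
  rewrite big_nil; under eq_fun do rewrite big_nil; exact: is_derive_cst.
by rewrite big_cons; under eq_fun do rewrite big_cons; exact: is_deriveD.
Qed.

Lemma esum_seq (T : choiceType) (A : set T) (s : seq T) (f : T -> R) :
  uniq s -> A = [set` s] -> (forall x, x \in s -> 0 <= f x) ->
  (\esum_(x in A) (f x)%:E = (\sum_(x <- s) f x)%:E)%E.
Proof.
move=> us -> f0; rewrite esum_fset//.
- by rewrite -fsbig_seq// sumEFin.
- by move=> x; rewrite inE/= lee_fin => /f0.
Qed.

End FiniteSums.

(** * Weights of individual paths and their differential equations *)

Section Weights.
Variables (R : realType) (G : digraph) (k : edge G -> R -> R).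
Implicit Types (i j : vertex G) (a : edge G) (e : seq (edge G)) (s t : R).

Definition out_edges i : seq (edge G) :=
  finmap.enum_fset (fset_set [set a | src a = i]).
Definition in_edges i : seq (edge G) :=
  finmap.enum_fset (fset_set [set a | tgt a = i]).

Definition exit_rate i t : R := \sum_(a <- out_edges i) k a t.

Definition end_vertex i e : vertex G := if e is a :: _ then tgt a else i.

(* Paths are encoded by their initial vertex and the list of their edges in
   reverse order, so that the last edge of a path is the head of the list. *)
Fixpoint rev_path i e : bool :=
  if e is a :: e' then (src a == end_vertex i e') && rev_path i e' else true.

Definition exit_primitive i t : R := \sum_(a <- out_edges i) primitive R (k a) t.

(* [weight i e t] is the contribution of the path [e] to the formal solution for
   the initial condition concentrated at [i]; the variation of constants formula
   integrates over the time of the last jump. *)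
Fixpoint weight i e : R -> R :=
  if e is a :: e' then fun t => expR (- exit_primitive (tgt a) t) *
    primitive R (fun s => expR (exit_primitive (tgt a) s) * k a s * weight i e' s) t
  else fun t => expR (- exit_primitive i t).

(** The inhomogeneous term in the equation for [weight]: arrival through the last edge. *)
Definition influx i e t : R := if e is a :: e' then k a t * weight i e' t else 0.

Hypothesis k_continuous : forall a, continuous (k a).
Hypothesis k_ge0 : forall a s, 0 <= k a s.

Lemma exit_rate_ge0 i t : 0 <= exit_rate i t.
Proof. exact: sumr_ge0. Qed.

Lemma exit_rate_continuous i : continuous (exit_rate i).
Proof. exact: continuous_sum_seq. Qed.

Lemma is_derive_exit_primitive i t :
  is_derive t 1 (exit_primitive i) (exit_rate i t).
Proof. by apply: is_derive_sum_seq => a; exact: is_derive_primitive. Qed.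

Lemma is_derive_expR_exit i t :
  is_derive t 1 (fun t => expR (exit_primitive i t))
    (exit_rate i t * expR (exit_primitive i t)).
Proof.
rewrite mulrC; apply: is_derive1_comp; exact: is_derive_exit_primitive.
Qed.

Lemma is_derive_expRN_exit i t :
  is_derive t 1 (fun t => expR (- exit_primitive i t))
    (- exit_rate i t * expR (- exit_primitive i t)).
Proof.
rewrite mulrC; apply: is_derive1_comp; apply: is_deriveN.
exact: is_derive_exit_primitive.
Qed.

(** Variation of constants. The induction supplies the continuity of the shorter weight, without
    which the primitive could not be differentiated. *)
Lemma is_derive_weight i e t :
  is_derive t 1 (weight i e)
    (- exit_rate (end_vertex i e) t * weight i e t + influx i e t).
Proof.
elim: e t => [|a e IHe] t; first by rewrite addr0; exact: is_derive_expRN_exit.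
have cw := derive_continuous _ _ _ IHe.
have cE := derive_continuous _ _ _ (is_derive_expR_exit (tgt a)).
have dP : is_derive t 1 (primitive R
    (fun s => expR (exit_primitive (tgt a) s) * k a s * weight i e s))
    (expR (exit_primitive (tgt a) t) * k a t * weight i e t).
  apply: is_derive_primitive => s; apply: cvgM; last exact: cw.
  by apply: cvgM; [exact: cE|exact: k_continuous].
have dM := is_deriveM (is_derive_expRN_exit (tgt a) t) dP.
apply: (is_derive_eq dM); rewrite /GRing.scale/= addrC; congr (_ + _).
  by ring.
by rewrite !mulrA -expRD addNr expR0 mul1r.
Qed.

Lemma weight_continuous i e : continuous (weight i e).
Proof. exact: (derive_continuous _ _ _ (is_derive_weight i e)). Qed.

Lemma weight_integrand_continuous i a e : continuous
  (fun s => expR (exit_primitive (tgt a) s) * k a s * weight i e s).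
Proof.
have cE := derive_continuous _ _ _ (is_derive_expR_exit (tgt a)).
move=> s; apply: cvgM; last exact: weight_continuous.
by apply: cvgM; [exact: cE|exact: k_continuous].
Qed.

Lemma weight_ge0 i e t : 0 <= t -> 0 <= weight i e t.
Proof.
elim: e t => [|a e IHe] t t0 /=; first exact: expR_ge0.
rewrite mulr_ge0 ?expR_ge0// primitive_ge0// => [|s s0].
  exact: weight_integrand_continuous.
by rewrite !mulr_ge0 ?expR_ge0 ?IHe.
Qed.

Lemma weight_nil0 i : weight i [::] 0 = 1.
Proof.
rewrite /= /exit_primitive big1 => [|a _]; first by rewrite oppr0 expR0.
exact: primitive0.
Qed.

Lemma weight_cons0 i a e : weight i (a :: e) 0 = 0.
Proof. by rewrite /= primitive0 mulr0. Qed.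

Hypothesis finite_out : forall i, finite_set [set a : edge G | src a = i].
Hypothesis finite_in : forall i, finite_set [set a : edge G | tgt a = i].
Hypothesis exit_rate_bounded : forall t, exists M : R,
  forall i s, 0 <= s <= t -> exit_rate i s <= M.

Lemma mem_out_edges i a : (a \in out_edges i) = (src a == i).
Proof.
by apply/idP/eqP => [|h]; rewrite /out_edges in_fset_set ?inE.
Qed.

Lemma mem_in_edges i a : (a \in in_edges i) = (tgt a == i).
Proof.
by apply/idP/eqP => [|h]; rewrite /in_edges in_fset_set ?inE.
Qed.

(** * Mass of the paths with a given initial vertex *)

Fixpoint paths_from i n : seq (seq (edge G)) :=
  if n is m.+1
  then [seq a :: e | e <- paths_from i m, a <- out_edges (end_vertex i e)]
  else [:: [::]].

Lemma mem_paths_from i n e :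
  (e \in paths_from i n) = (size e == n) && rev_path i e.
Proof.
elim: n e => [|n IHn] [|a e] //=.
  by apply/negbTE/negP => /allpairsPdep[? [? [_ _ ?]]].
apply/allpairsPdep/idP => [[e' [a' [+ + [-> ->]]]]|].
  by rewrite IHn mem_out_edges eqSS => /andP[-> ->] ->.
rewrite eqSS andbCA => /andP[ae en]; exists e, a.
by rewrite IHn mem_out_edges.
Qed.

Lemma uniq_paths_from i n : uniq (paths_from i n).
Proof.
elim: n => [|n IHn]//=; apply: allpairs_uniq_dep => //.
  by move=> e _; exact: finmap.fset_uniq.
by move=> [e a] [e' a'] _ _ /= [-> ->].
Qed.

Definition mass i n t : R := \sum_(e <- paths_from i n) weight i e t.

Definition mass_outflow i n t : R :=
  \sum_(e <- paths_from i n) exit_rate (end_vertex i e) t * weight i e t.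

Lemma mass_ge0 i n t : 0 <= t -> 0 <= mass i n t.
Proof. by move=> t0; apply: sumr_ge0 => e _; exact: weight_ge0. Qed.

Lemma mass_outflow_ge0 i n t : 0 <= t -> 0 <= mass_outflow i n t.
Proof.
move=> t0; apply: sumr_ge0 => e _.
by rewrite mulr_ge0 ?exit_rate_ge0 ?weight_ge0.
Qed.

Lemma mass_outflow_le i n t M : 0 <= t ->
  (forall j, exit_rate j t <= M) -> mass_outflow i n t <= M * mass i n t.
Proof.
move=> t0 hM; rewrite /mass mulr_sumr; apply: ler_sum => e _.
by rewrite ler_wpM2r ?weight_ge0.
Qed.

(** A path of length n + 1 is a path of length n followed by an edge out of its end vertex, and the
    rates of these edges add up to the exit rate. *)
Lemma sum_influx i n t :
  \sum_(e <- paths_from i n.+1) influx i e t = mass_outflow i n t.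
Proof.
rewrite big_allpairs_dep; apply: eq_bigr => e _ /=.
by rewrite -mulr_suml.
Qed.

Lemma is_derive_mass i n t : is_derive t 1 (mass i n)
  ((if n is m.+1 then mass_outflow i m t else 0) - mass_outflow i n t).
Proof.
have := is_derive_sum_seq R _ (paths_from i n) (weight i) _ t
  (fun e => is_derive_weight i e t).
move=> H; apply: (is_derive_eq H); rewrite big_split/= addrC; congr (_ + _).
  by case: n {H} => [|n]; [rewrite big_seq1|rewrite sum_influx].
by rewrite -sumrN; apply: eq_bigr => e _; rewrite mulNr.
Qed.

Lemma mass00 i : mass i 0 0 = 1.
Proof. by rewrite /mass big_seq1; exact: weight_nil0. Qed.

Lemma massS0 i n : mass i n.+1 0 = 0.
Proof.
rewrite /mass big_allpairs_dep big1// => e _; rewrite big1// => a _.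
exact: weight_cons0.
Qed.

Definition mass_upto i n t : R := \sum_(m < n.+1) mass i m t.

Lemma mass_upto0 i n : mass_upto i n 0 = 1.
Proof.
rewrite /mass_upto big_ord_recl mass00 big1 ?addr0// => m _; exact: massS0.
Qed.

(* The outflow of each level is the inflow of the next one. *)
Lemma is_derive_mass_upto i n t :
  is_derive t 1 (mass_upto i n) (- mass_outflow i n t).
Proof.
rewrite /mass_upto; elim: n => [|n IHn].
  under eq_fun do rewrite big_ord1.
  by apply: (is_derive_eq (is_derive_mass i 0 t)); rewrite sub0r.
under eq_fun do rewrite big_ord_recr/=.
by apply: (is_derive_eq (is_deriveD IHn (is_derive_mass i n.+1 t))); rewrite addKr.
Qed.

(** Level 0 starts at 1 and decreases. Level n + 1 grows at most at the rate M times the mass of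
    level n, which by induction is at most the derivative of the claimed bound; both sides vanish at
    0. *)
Lemma mass_le_exp_coeff i n t (M : R) : 0 <= M -> 0 <= t ->
  (forall j s, 0 <= s <= t -> exit_rate j s <= M) ->
  mass i n t <= exp_coeff (M * t) n.
Proof.
move=> M0; elim: n t => [|n IHn] t t0 hM.
  rewrite /exp_coeff/= expr0 fact0 divr1 -(mass00 i) -lerN2.
  apply: (ge0_is_derive_le _ (- mass i 0) _ t t0) => s.
    exact: is_deriveN (is_derive_mass i 0 s).
  by move=> /andP[s0 _] /=; rewrite sub0r opprK mass_outflow_ge0.
rewrite -subr_ge0.
have := ge0_is_derive_le _ (fun s => exp_coeff (M * s) n.+1 - mass i n.+1 s) _ t t0
  (fun s => is_deriveB (is_derive_exp_coeff R M s n) (is_derive_mass i n.+1 s)).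
rewrite massS0 subr0 mulr0 exp_coeff0S; apply => s /andP[s0 st].
rewrite opprB addrCA addr_ge0 ?mass_outflow_ge0// subr_ge0.
apply: (le_trans (mass_outflow_le _ _ _ M s0 _)).
  by move=> j; apply: hM; rewrite s0.
rewrite ler_wpM2l// IHn// => j r /andP[r0 rs].
by apply: hM; rewrite r0 (le_trans rs).
Qed.

Lemma mass_upto_le1 i n t : 0 <= t -> mass_upto i n t <= 1.
Proof.
move=> t0; rewrite -(mass_upto0 i n) -lerN2.
apply: (ge0_is_derive_le _ (- mass_upto i n) _ t t0) => s.
  exact: is_deriveN (is_derive_mass_upto i n s).
by move=> /andP[s0 _] /=; rewrite opprK mass_outflow_ge0.
Qed.

(** The outflow of level n is at most M (M s)^n / n!, so adding (M s)^(n+1) / (n+1)! to the mass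
    gives a function that starts at 1 and does not decrease on [0, t]. *)
Lemma mass_upto_ge i n t (M : R) : 0 <= M -> 0 <= t ->
  (forall j s, 0 <= s <= t -> exit_rate j s <= M) ->
  1 - exp_coeff (M * t) n.+1 <= mass_upto i n t.
Proof.
move=> M0 t0 hM; rewrite lerBlDl.
have := ge0_is_derive_le _ (fun s => exp_coeff (M * s) n.+1 + mass_upto i n s) _ t t0
  (fun s => is_deriveD (is_derive_exp_coeff R M s n) (is_derive_mass_upto i n s)).
rewrite mass_upto0 mulr0 exp_coeff0S add0r; apply => s /andP[s0 st].
rewrite subr_ge0; apply: (le_trans (mass_outflow_le _ _ _ M s0 _)).
  by move=> j; apply: hM; rewrite s0.
rewrite ler_wpM2l// mass_le_exp_coeff// => j r /andP[r0 rs].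
by apply: hM; rewrite r0 (le_trans rs).
Qed.

Lemma mass_upto_cvg i t : 0 <= t -> mass_upto i n t @[n --> \oo] --> (1 : R).
Proof.
move=> t0; have [M hM] := exit_rate_bounded t.
have M0 : 0 <= M.
  by apply: le_trans (hM i 0 _); rewrite ?exit_rate_ge0 ?lexx.
apply: (@squeeze_cvgr _ _ _ _ (fun n => 1 - exp_coeff (M * t) n.+1) (cst 1)).
- by apply: nearW => n; rewrite mass_upto_ge ?mass_upto_le1.
- rewrite -[X in _ --> X]subr0; apply: cvgB; first exact: cvg_cst.
  (* The error is a term of the convergent exponential series. *)
  rewrite (cvg_shiftS (exp_coeff (M * t))).
  exact/cvg_series_cvg_0/is_cvg_series_exp_coeff.
- exact: cvg_cst.
Qed.

Lemma mass_total i t : 0 <= t -> (\sum_(0 <= n <oo) (mass i n t)%:E = 1)%E.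
Proof.
move=> t0; apply/cvg_lim => //; rewrite -(cvg_shiftS (fun n => \sum_(0 <= m < n) _)%E).
rewrite (_ : (fun n => _) = (fun n => (mass_upto i n t)%:E)).
  by apply: cvg_EFin; [exact: nearW|exact: mass_upto_cvg].
by apply/funext => n; rewrite big_mkord sumEFin.
Qed.

(** * Averaging over the initial distribution *)

Variable q : vertex G -> R.
Hypothesis q_prob : prob_dist q.

Definition path_set n : set (vertex G * seq (edge G)) :=
  [set: vertex G] `*`` (fun i => [set e | size e = n /\ rev_path i e]).

Definition path_weight (x : vertex G * seq (edge G)) t : R :=
  q x.1 * weight x.1 x.2 t.

Lemma path_weight_ge0 x t : 0 <= t -> 0 <= path_weight x t.
Proof. by move=> t0; rewrite mulr_ge0 ?weight_ge0//; case: q_prob. Qed.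

Lemma esum_path_set n t : 0 <= t ->
  (\esum_(x in path_set n) (path_weight x t)%:E =
   \esum_(i in [set: vertex G]) ((q i)%:E * (mass i n t)%:E))%E.
Proof.
move=> t0; rewrite /path_set /path_weight.
rewrite -(@esum_esum _ _ _ _ _ (fun i e => (q i * weight i e t)%:E)).
  apply: eq_esum => i _; rewrite (esum_seq _ _ _ (paths_from i n)).
  - by rewrite -EFinM /mass mulr_sumr.
  - exact: uniq_paths_from.
  - apply/seteqP; split=> e /=; rewrite mem_paths_from.
      by move=> [-> ->]; rewrite eqxx.
    by move=> /andP[/eqP].
  - by move=> e _; exact: (path_weight_ge0 (i, e)).
by move=> i e _ _; rewrite lee_fin (path_weight_ge0 (i, e)).
Qed.

(** After exchanging the sums over lengths and initial vertices, each initial vertex contributes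
    total mass 1, which leaves the sum of [q]. *)
Lemma sum_path_weight t : 0 <= t ->
  (\sum_(0 <= n <oo) \esum_(x in path_set n) (path_weight x t)%:E = 1)%E.
Proof.
move=> t0; have [q0 q1] := q_prob.
under eq_eseriesr do rewrite esum_path_set//.
have qm0 i n : (0 <= (q i)%:E * (mass i n t)%:E)%E.
  by rewrite mule_ge0// lee_fin// mass_ge0.
rewrite nneseries_esumT => [|n]; last exact: esum_ge0.
rewrite esum_exchange// -[RHS]q1; apply: eq_esum => i _.
rewrite -nneseries_esumT// nneseriesZl ?mass_total ?mule1// => n _.
by rewrite lee_fin mass_ge0.
Qed.

(** * Paths with a given end vertex and the formal solution *)

Fixpoint paths_to i n : seq (vertex G * seq (edge G)) :=
  if n is m.+1
  then [seq (x.1, a :: x.2) | a <- in_edges i, x <- paths_to (src a) m]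
  else [:: (i, [::])].

Lemma mem_paths_to i n x : (x \in paths_to i n) =
  [&& size x.2 == n, rev_path x.1 x.2 & end_vertex x.1 x.2 == i].
Proof.
elim: n i x => [|n IHn] i [j e] /=.
  rewrite inE xpair_eqE; case: e => [|a e] /=; first by rewrite andbT.
  by rewrite andbF.
apply/allpairsPdep/idP => [[a [[j' e'] [+ + [-> ->]]]]|].
  by rewrite mem_in_edges IHn/= eqSS => -> /and3P[-> -> /eqP->]; rewrite eqxx.
case: e => [//|a e] /=; rewrite eqSS => /and3P[en /andP[ae pe] ai].
exists a, (j, e); rewrite mem_in_edges IHn/= ai en pe eq_sym ae.
by split.
Qed.

Lemma uniq_paths_to i n : uniq (paths_to i n).
Proof.
elim: n i => [|n IHn] i //=; apply: allpairs_uniq_dep => //.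
  exact: finmap.fset_uniq.
by move=> [a [j e]] [a' [j' e']] _ _ /= [-> -> ->].
Qed.

Definition formal_term n i t : R := \sum_(x <- paths_to i n) path_weight x t.

Lemma formal_term_ge0 n i t : 0 <= t -> 0 <= formal_term n i t.
Proof. by move=> t0; apply: sumr_ge0 => x _; exact: path_weight_ge0. Qed.

Lemma formal_term_at0 n i : formal_term n i 0 = if n is 0%N then q i else 0.
Proof.
case: n => [|n]; rewrite /formal_term.
  by rewrite big_seq1 /path_weight weight_nil0 mulr1.
rewrite big_allpairs_dep big1// => a _; rewrite big1// => x _.
by rewrite /path_weight weight_cons0 mulr0.
Qed.

Lemma is_derive_formal_term n i t : is_derive t 1 (formal_term n i)
  (- exit_rate i t * formal_term n i t +
   if n is m.+1 then \sum_(a <- in_edges i) k a t * formal_term m (src a) t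
   else 0).
Proof.
have dw x : is_derive t 1 (path_weight x) _ :=
  is_deriveZ (q x.1) (is_derive_weight x.1 x.2 t).
have := is_derive_sum_seq R _ (paths_to i n) path_weight _ t dw.
move=> H; apply: (is_derive_eq H) => {H}.
under eq_bigr do rewrite /GRing.scale/= mulrDr.
rewrite big_split/=; congr (_ + _).
  rewrite mulr_sumr; apply: eq_big_seq => x; rewrite mem_paths_to.
  by move=> /and3P[_ _ /eqP ->]; rewrite mulrCA.
case: n => [|n]; first by rewrite big_seq1 mulr0.
rewrite big_allpairs_dep; apply: eq_bigr => a _; rewrite mulr_sumr.
by apply: eq_bigr => x _; rewrite /= mulrCA.
Qed.

(** Grouping the edges out of [i] by target loses none of them, since without loops every target
    differs from [i]. *)
Lemma master_op_diag i t : master_op k i i t = - exit_rate i t.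
Proof.
rewrite /master_op eqxx; congr (- _).
apply: (fsum_fibre R _ _ [set a | src a = i] [set l | l <> i] (@tgt G)
  (fun _ a => k a t)) => //.
by move=> a <- /esym; exact: src_neq_tgt.
Qed.

Lemma master_op_diag_continuous i : continuous (master_op k i i).
Proof.
rewrite (_ : master_op k i i = fun t => - exit_rate i t).
  by move=> t; apply: cvgN; exact: exit_rate_continuous.
by apply/funext => t; exact: master_op_diag.
Qed.

Lemma master_op_offdiag i (p : vertex G -> R) t :
  \sum_(j \in [set j | j <> i]) master_op k i j t * p j =
  \sum_(a <- in_edges i) k a t * p (src a).
Proof.
rewrite -[RHS](fsum_fibre R _ _ [set a | tgt a = i] [set j | j <> i] (@src G)
  (fun j a => k a t * p j))//; last first.
  by move=> a <-; exact: src_neq_tgt.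
apply: eq_fsbigr => j; rewrite inE => ji.
rewrite /master_op; case: eqP => [/esym//|_].
by rewrite mulr_fsuml setIC.
Qed.

Lemma formal_term_is_formal_solution : is_formal_solution k q formal_term.
Proof.
split=> [n i|n i t t0]; first exact: formal_term_at0.
rewrite master_op_diag; apply: is_derive_is_derive_nneg.
apply: (is_derive_eq (is_derive_formal_term n i t)); congr (_ + _).
by case: n => // n; rewrite master_op_offdiag.
Qed.

(** Once level n - 1 is determined, each component of level n solves a scalar linear equation with
    continuous coefficient h_ii and known inhomogeneous term. *)
Lemma formal_solution_unique p : is_formal_solution k q p ->
  forall n i t, 0 <= t -> p n i t = formal_term n i t.
Proof.
move=> [p0 dp] n; have [f0 df] := formal_term_is_formal_solution.
elim: n => [|n IHn] i.
  apply: (linear_ode_unique _ (master_op k i i) (cst 0)).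
  - exact: master_op_diag_continuous.
  - by move=> s s0; exact: dp 0%N i s s0.
  - by move=> s s0; exact: df 0%N i s s0.
  - by rewrite p0 f0.
apply: (linear_ode_unique _ (master_op k i i)
  (fun s => \sum_(a <- in_edges i) k a s * formal_term n (src a) s)).
- exact: master_op_diag_continuous.
- move=> s s0; have := dp n.+1 i s s0.
  rewrite master_op_offdiag; congr is_derive_nneg; congr (_ + _).
  by apply: eq_bigr => a _; rewrite IHn.
- by move=> s s0; have := df n.+1 i s s0; rewrite master_op_offdiag.
- by rewrite p0 f0.
Qed.

(** Every path has exactly one end vertex, so the lists [paths_to i n] partition [path_set n]. *)
Lemma esum_formal_term n t : 0 <= t ->
  (\esum_(i in [set: vertex G]) (formal_term n i t)%:E =
   \esum_(x in path_set n) (path_weight x t)%:E)%E.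
Proof.
move=> t0; transitivity (\esum_(i in [set: vertex G])
    \esum_(x in [set` paths_to i n]) (path_weight x t)%:E)%E.
  apply: eq_esum => i _; rewrite (esum_seq _ _ _ (paths_to i n))//.
    exact: uniq_paths_to.
  by move=> x _; exact: path_weight_ge0.
rewrite esum_esum => [|i x _ _]; last by rewrite lee_fin path_weight_ge0.
apply/esym/(reindex_esum _ _ (fun z => z.2)); split.
- move=> [i [j e]] [_ /=]; rewrite mem_paths_to => /and3P[/eqP ? ? _].
  by split.
- move=> [i x] [i' x']; rewrite !inE => -[_ +] [_ +] /= xx'.
  rewrite /= {}xx' !mem_paths_to.
  by move=> /and3P[_ _ /eqP <-] /and3P[_ _ /eqP <-].
- move=> [j e] [_ [/= en pe]]; exists (end_vertex j e, (j, e)) => //.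
  by split=> //=; rewrite mem_paths_to/= en pe !eqxx.
Qed.

Lemma esum_sum_formal_term t : 0 <= t ->
  (\esum_(i in [set: vertex G]) \sum_(0 <= n <oo) (formal_term n i t)%:E = 1)%E.
Proof.
move=> t0; have f0 n i : (0 <= (formal_term n i t)%:E)%E.
  by rewrite lee_fin formal_term_ge0.
rewrite -(sum_path_weight t t0).
under [RHS]eq_eseriesr do rewrite -esum_formal_term//.
rewrite [RHS]nneseries_esumT => [|n]; last exact: esum_ge0.
by rewrite esum_exchange//; apply: eq_esum => i _; rewrite nneseries_esumT.
Qed.

(** Each component's series has nonnegative terms and is bounded by the total mass 1, so it
    converges in the reals; its limit then agrees with the extended real sum, to which the total
    mass formula applies. *)
Lemma formal_term_prob_dist t : 0 <= t -> series_is_prob_dist formal_term t.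
Proof.
move=> t0; have f0 n i : (0 <= (formal_term n i t)%:E)%E.
  by rewrite lee_fin formal_term_ge0.
have S1 i : (\sum_(0 <= n <oo) (formal_term n i t)%:E <= 1)%E.
  rewrite -(esum_sum_formal_term t t0); apply: esum_ge; exists [set i].
    by split.
  by rewrite fsbig_set1.
have cS i : cvgn (series (fun n => formal_term n i t)).
  apply: nondecreasing_is_cvgn.
    by apply: nondecreasing_series => n _ _; exact: formal_term_ge0.
  exists 1 => _ [n _ <-]; rewrite -lee_fin (le_trans _ (S1 i))//.
  by rewrite /series/= -sumEFin; exact: nneseries_lim_ge.
have ES i : (\sum_(0 <= n <oo) (formal_term n i t)%:E =
    (limn (series (fun n => formal_term n i t)))%:E)%E.
  rewrite -EFin_lim//; congr (limn _); apply/funext => n /=.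
  by rewrite /series/= -sumEFin.
split=> //; split=> [i|].
  by rewrite -lee_fin -ES; apply: nneseries_ge0.
by rewrite -(esum_sum_formal_term t t0); apply: eq_esum => i _; rewrite ES.
Qed.

Lemma formal_solution_prob_dist p : is_formal_solution k q p ->
  forall t, 0 <= t -> series_is_prob_dist p t.
Proof.
move=> hp t t0; have := formal_term_prob_dist t t0.
have E i : (fun n => p n i t) = (fun n => formal_term n i t).
  by apply/funext => n; exact: formal_solution_unique.
rewrite /series_is_prob_dist.
rewrite (_ : (fun i => limn _) = fun i => limn (series (fun n => p n i t))).
  by move=> [cS pS]; split=> // i; rewrite E.
by apply/funext => i; rewrite E.
Qed.

(** * The trajectory density and its integrals over simplices *)

Lemma stay_probE i (a b : R) : a <= b ->
  stay_prob k i a b = expR (- exit_primitive i b) * expR (exit_primitive i a).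
Proof.
move=> ab; rewrite -expRD; congr expR.
rewrite addrC -opprB; congr (- _).
rewrite fsbig_finite// /exit_primitive -sumrB; apply: eq_bigr => e _.
by rewrite /Rintegral integral_primitive.
Qed.

Lemma trajectory_density_ge0 t n (x : vertex G * n.-tuple (edge G))
  (ts : n.-tuple R) : 0 <= trajectory_density k q t x ts.
Proof.
rewrite /trajectory_density !mulr_ge0//; first by case: q_prob.
  by apply: prodr_ge0 => m _; exact: expR_ge0.
exact: prodr_ge0.
Qed.

Lemma end_vertex_rev i e : end_vertex i (rev e) = last i (map (@tgt G) e).
Proof. by case/lastP: e => [|e a] //; rewrite rev_rcons map_rcons last_rcons. Qed.

Lemma rev_path_rev i e : rev_path i (rev e) <->
  sorted (fun a b => tgt a == src b) e /\ head i (map (@src G) e) = i.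
Proof.
elim/last_ind: e => [|e a IHe] //; rewrite rev_rcons /= end_vertex_rev.
(* If [a] is the only edge, the test on its source is the condition on the initial vertex; otherwise
   it is the last link of the chain. *)
case: e IHe => [|b e] IHe /=.
  by rewrite andbT; split=> [/eqP|[_ /eqP]].
rewrite rcons_path last_map [src a == _]eq_sym; split.
  by move=> /andP[-> /IHe [/= -> ->]].
by move=> [/andP[pe ->] bi]; apply/IHe.
Qed.

Lemma paths_bij n :
  set_bij (@paths G n) (path_set n) (fun x => (x.1, rev (x.2 : seq (edge G)))).
Proof.
split.
- move=> [i e] /= ep; split=> //=; rewrite size_rev size_tuple; split=> //.
  exact/rev_path_rev.
- move=> [i e] [j f] _ _ /= [-> /(congr1 rev)]; rewrite !revK => ef.
  by congr (_, _); exact: val_inj.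
- move=> [i e] [_ /= [en ep]].
  have sz : size (rev e) == n by rewrite size_rev en.
  exists (i, Tuple sz); last by rewrite /= revK.
  by apply/rev_path_rev; rewrite revK.
Qed.

(** Cutting a trajectory at its last jump time [s] leaves a trajectory of duration [s]; the rest is
    the jump through [a] and the stay until [t]. *)
Lemma trajectory_density_rcons t n i (y : n.-tuple (edge G)) a
    (ts : n.-tuple R) s : last i (map (@tgt G) y) = src a ->
  trajectory_density k q t (i, [tuple of rcons y a]) [tuple of rcons ts s] =
  trajectory_density k q s (i, y) ts * (stay_prob k (tgt a) s t * k a s).
Proof.
move=> ia; have pvE : path_vertices (i, [tuple of rcons y a]) =
    rcons (path_vertices (i, y)) (tgt a).
  by rewrite /path_vertices/= !map_rcons last_rcons ia.
have pvS : size (path_vertices (i, y)) = n.+1.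
  by rewrite size_rcons size_map size_tuple.
have tS : size (times s ts) = n.+2 by rewrite /= size_rcons size_tuple.
have timesE : times t [tuple of rcons ts s] = rcons (times s ts) t by [].
rewrite /trajectory_density pvE timesE.
have tE : nth 0 (times s ts) n.+1 = s by rewrite /= nth_rcons size_tuple ltnn eqxx.
rewrite (prod_nth_rcons _ _ (stay_prob k) n.+1)// prod_tnth_rcons tE.
by rewrite /= [RHS]mulrACA !mulrA.
Qed.

(** The factor [c] makes the induction work: for a fixed last jump time, the factors of the last
    jump do not depend on the earlier times and are absorbed into [c]. The remaining outer integral
    is the one defining [weight]. *)
Lemma simplex_integral_trajectory_density n x (c t : R) :
  0 <= t -> paths x ->
  simplex_integral t (fun ts : n.-tuple R => trajectory_density k q t x ts * c) =
  (path_weight (x.1, rev x.2) t * c)%:E.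
Proof.
elim: n x c t => [|n IHn] [i e] c t t0.
  move=> _ /=; rewrite (tuple0 e) /trajectory_density/= big_ord1 big_ord0/=.
  rewrite mulr1 stay_probE// /path_weight/=.
  have := weight_nil0 i => /= wi.
  suff -> : exit_primitive i 0 = 0 by rewrite expR0 mulr1.
  by rewrite /exit_primitive big1// => a _; exact: primitive0.
have [y [a ->]] := tuple_rcons _ _ e.
move=> /rev_path_rev; rewrite rev_rcons /= end_vertex_rev => /andP[/eqP ya yp].
pose f s := expR (exit_primitive (tgt a) s) * k a s * weight i (rev y) s.
(* [C] collects what does not depend on [s], after the stay probability on [s, t] is split into a
   factor in [t] and a factor in [s]. *)
pose C := q i * c * expR (- exit_primitive (tgt a) t).
have cf : continuous f by exact: weight_integrand_continuous.
transitivity (\int[@lebesgue_measure R]_(s in `[0%R, t]) (C * f s)%:E)%E.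
  apply: eq_integral => s; rewrite inE/= in_itv/= => /andP[s0 st].
  under eq_fun do rewrite trajectory_density_rcons// -mulrA.
  rewrite IHn//; last by apply/rev_path_rev.
  rewrite stay_probE//; congr EFin; rewrite /path_weight /C /f /=.
  by ring.
have dF s : is_derive s 1 (C \*: primitive R f) (C * f s).
  by apply: is_deriveZ; exact: is_derive_primitive.
have cCf : continuous (fun s => C * f s).
  by move=> s; apply: cvgM; [exact: cvg_cst|exact: cf].
rewrite (integral_is_derive _ _ _ _ _ cCf dF t0) /= primitive0 scaler0 subr0.
by rewrite /path_weight/= /C /GRing.scale/= -/f; congr EFin; ring.
Qed.

Lemma trajectory_density_prob t : 0 <= t ->
  trajectory_prob_density t (@trajectory_density R G k q t).
Proof.
move=> t0; split=> [n x ts _|]; first exact: trajectory_density_ge0.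
rewrite -(sum_path_weight t t0); apply: eq_eseriesr => n _.
rewrite (reindex_esum _ _ _ _ (paths_bij n)); apply: eq_esum => x px.
have := simplex_integral_trajectory_density n x 1 t t0 px.
rewrite mulr1 => <-; congr simplex_integral.
by apply/funext => ts; rewrite mulr1.
Qed.

End Weights.

(** * Uniform bounds on the exit rates *)

Section RateBounds.
Variables (R : realType) (G : digraph) (k : edge G -> R -> R).

(** Each rate attains a maximum on [0, t]; as rates are nonnegative, the sum of these finitely many
    maxima dominates all of them. *)
Lemma finite_rate_bound : finite_digraph G -> (forall a, continuous (k a)) ->
  (forall a s, 0 <= k a s) -> rate_bound k.
Proof.
move=> [_ fE] kc k0 t t0.
have /choice[c hc] (a : edge G) : exists c, forall s, 0 <= s <= t -> k a s <= k a c.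
  have [|c _ hc] := EVT_max (ltW t0) (f := k a).
    by apply: continuous_subspaceT; exact: kc.
  by exists c => s st; apply: hc; rewrite in_itv.
exists (\sum_(a <- finmap.enum_fset (fset_set [set: edge G])) k a (c a)) => s a st.
rewrite (le_trans (hc a s st))// (bigD1_seq a) ?finmap.fset_uniq//=.
  by rewrite lerDl sumr_ge0.
by rewrite in_fset_set// inE.
Qed.

Lemma finite_degree_bound : finite_digraph G -> degree_bound G.
Proof.
(* The successor guarantees a positive degree bound even if there are no edges. *)
move=> [_ /finite_set_leP[n hn]]; exists n.+1 => // i.
apply: card_le_trans (subset_card_le (@subsetT _ _)) _.
by apply: card_le_trans hn _; rewrite card_le_II.
Qed.

Lemma transition_rates_bounds : transition_rates k -> rate_bound k /\ degree_bound G.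
Proof.
move=> [kc k0 hinf]; have [fG|] := pselect (finite_digraph G); last exact: hinf.
by split; [exact: finite_rate_bound|exact: finite_degree_bound].
Qed.

Lemma degree_bound_out : degree_bound G ->
  exists D, forall i, ([set a : edge G | src a = i] #<= `I_D)%card.
Proof.
move=> [D _ hD]; exists D => i; apply: card_le_trans (hD i).
by apply: subset_card_le => a /= ai; left.
Qed.

Lemma degree_bound_finite_in : degree_bound G ->
  forall i, finite_set [set a : edge G | tgt a = i].
Proof.
move=> [D _ hD] i; apply/finite_set_leP; exists D; apply: card_le_trans (hD i).
by apply: subset_card_le => a /= ai; right.
Qed.

Lemma exit_rate_le (D : nat) : (forall a s, 0 <= k a s) -> rate_bound k ->
  (forall i, ([set a : edge G | src a = i] #<= `I_D)%card) ->
  forall t, exists M, forall i s, 0 <= s <= t -> exit_rate R G k i s <= M.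
Proof.
(* The maximum with 1 provides the positive time that [rate_bound] asks for. *)
move=> k0 kb hD t; have [C hC] := kb (Num.max t 1) ltac:(by rewrite lt_max ltr01 orbT).
(* Without edges [C] could be negative; the absolute value makes the bound monotone in the number of
   outgoing edges. *)
exists (`|C| *+ D) => i s /andP[s0 st].
apply: (@le_trans _ _ (\sum_(a <- out_edges G i) `|C|)).
  apply: ler_sum => a _; rewrite (le_trans _ (ler_norm C))// hC// s0.
  by rewrite le_max st.
rewrite big_const_seq count_predT iter_addr_0.
by apply: ler_wpMn2l => //; exact: geq_card_fset_set.
Qed.

End RateBounds.

Theorem corollary3p2 (R : realType) (G : digraph) (k : edge G -> R -> R)
    (q : vertex G -> R) (hk : transition_rates k) (hq : prob_dist q) :
  [/\ exists p : nat -> vertex G -> R -> R, is_formal_solution k q p,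
      forall p : nat -> vertex G -> R -> R, is_formal_solution k q p ->
        forall t : R, 0 <= t -> series_is_prob_dist p t &
      forall t : R, 0 < t ->
        trajectory_prob_density t (@trajectory_density R G k q t)].
Proof.
have [kc k0 _] := hk.
have [kb db] := transition_rates_bounds R G k hk.
have [D hD] := degree_bound_out G db.
have fin i := degree_bound_finite_in G db i.
have fout i : finite_set [set a : edge G | src a = i].
  by apply/finite_set_leP; exists D.
have eb := exit_rate_le R G k D k0 kb hD.
split.
- by exists (formal_term R G k q); exact: formal_term_is_formal_solution.
- move=> p hp t t0.
  exact: (formal_solution_prob_dist R G k kc k0 fout fin eb q hq p hp).
- by move=> t t0; apply: trajectory_density_prob => //; exact: ltW.
Qed.
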